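(* Let $\alpha\in(0,1)$ and let $(\alpha_i)_{i\in\mathbb{N}}$ be individual significance levels produced by an exhaustive ADDIS algorithm at level $\alpha$ with parameters $(\tau_i)_{i\in\mathbb{N}}$, $(\lambda_i)_{i\in\mathbb{N}}$ and running levels $(\alpha^{(i)})_{i\in\mathbb{N}}$, as defined in the context. Assume: (1) the null $p$-values are uniformly distributed on $[0,1]$ and independent; thus under the global null hypothesis $I_0=\mathbb{N}$ all $P_i$, $i\in\mathbb{N}$, are independent and uniform on $[0,1]$; (2) the levels are chosen such that, almost surely under the global null hypothesis, $\sum_{i\in\mathbb{N}}\alpha_i\frac{1-\alpha^{(i)}}{\tau_i-\lambda_i}(S_i-C_i)=\alpha$, where $S_i=\mathbf{1}\{P_i\le\tau_i\}$ and $C_i=\mathbf{1}\{P_i\le\lambda_i\}$; (3) for any event $E\in\mathcal{A}$ with $\mathbb{P}(E\mid I_0=\mathbb{N})=0$ it also holds that $\mathbb{P}(E)=0$, where $\mathbb{P}$ is the true data-generating distribution. Then there is no procedure $(\tilde\alpha_i)_{i\in\mathbb{N}}$ with (strong) FWER control at level $\alpha$ such that $$\{\exists i\in\mathbb{N}: P_i\le\tilde\alpha_i\}\supseteq\{\exists i\in\mathbb{N}: P_i\le\alpha_i\}$$ and $$\mathbb{P}\big(\{\exists i\in\mathbb{N}: P_i\le\tilde\alpha_i\}\setminus\{\exists i\in\mathbb{N}: P_i\le\alpha_i\}\big)>0 .$$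
   Context: Setting. $(\Omega,\mathcal{A})$ is a measurable space, $\mathcal{P}$ a set of probability distributions on it, and $\mathbb{P}\in\mathcal{P}$ the true data-generating distribution. $(H_i)_{i\in\mathbb{N}}$ is a sequence of null hypotheses about the distribution, with $p$-values $P_i:\Omega\to[0,1]$. $I_0\subseteq\mathbb{N}$ is the index set of true null hypotheses (it depends on the distribution), and $P_i$ is a null $p$-value if $i\in I_0$. The notation $\mathbb{P}(\,\cdot\mid I_0=\mathbb{N})$ denotes probability under the global null hypothesis, i.e. under the distribution in $\mathcal{P}$ for which all null hypotheses are true (it is not a conditional probability). Let $\mathcal{G}_{i}=\sigma(P_1,\ldots,P_{i})$, with $\mathcal{G}_0$ trivial. A procedure is a sequence $(\tilde\alpha_i)_{i\in\mathbb{N}}$ of individual significance levels, i.e. random variables with values in $[0,1)$ such that $\tilde\alpha_i$ is $\mathcal{G}_{i-1}$-measurable (depends only on $P_1,\dots,P_{i-1}$); it rejects $H_i$ iff $P_i\le\tilde\alpha_i$. Its familywise error rate is the probability of rejecting at least one true null hypothesis, $\text{FWER}=\mathbb{P}(\exists i\in I_0: P_i\le\tilde\alpha_i)$. (Strong) FWER control at level $\alpha$ means $\text{FWER}\le\alpha$ under any configuration of true and false hypotheses, in particular under the global null hypothesis. Exhaustive ADDIS algorithm at level $\alpha$. Put $\alpha^{(1)}=\alpha$. For each $i\in\mathbb{N}$, before observing $P_i$, one chooses $\mathcal{G}_{i-1}$-measurable random variables $\tau_i,\lambda_i,\alpha_i$ with $$\tau_i\in(0,1],\qquad \lambda_i\in[\alpha^{(i)}\tau_i,\tau_i),\qquad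 \alpha_i\in[0,\tau_i),\qquad \alpha^{(i)}-\frac{\alpha_i(1-\alpha^{(i)})}{\tau_i-\lambda_i}\ge 0 .$$ Then $H_i$ is rejected iff $P_i\le\alpha_i$, and one sets $$\alpha^{(i+1)}=\begin{cases}\alpha^{(i)} & \text{if } P_i\le\lambda_i \text{ or } P_i>\tau_i,\\[2pt] \alpha^{(i)}-\dfrac{\alpha_i(1-\alpha^{(i)})}{\tau_i-\lambda_i} & \text{if } \lambda_i<P_i\le\tau_i.\end{cases}$$ Any sequence of choices satisfying these constraints is allowed. *)

(* Defs.v *)
From HB Require Import structures.
From mathcomp Require Import all_boot all_order all_algebra.
From mathcomp Require Import finmap all_classical all_reals all_analysis.

Set Implicit Arguments.
Unset Strict Implicit.
Unset Printing Implicit Defensive.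

Import Order.TTheory GRing.Theory Num.Theory.
Import numFieldNormedType.Exports.

Local Open Scope classical_set_scope.
Local Open Scope ring_scope.

(* Sequences are indexed from 0: the hypothesis, p-value, level and parameters
   at index i here are those written with index i + 1 when counting from 1. *)

Section online_testing.
Context (d : measure_display) (Omega : measurableType d) (R : realType).
Implicit Types (Q : probability Omega R) (P : nat -> {mfun Omega >-> R}).

(* A null hypothesis is the set of distributions for which it is true. *)
Definition true_nulls (H : nat -> set (probability Omega R)) Q : set nat :=
  [set i | H i Q].

(* sigma(P_j, j < i); trivial for i = 0. *)
Definition history P (i : nat) : set (set Omega) :=
  g_sigma_preimage (fun j : 'I_i => P j : Omega -> R).

(* X i is measurable with respect to the p-values strictly before i. *)
Definition predictable P (X : nat -> Omega -> R) : Prop :=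
  forall i (B : set R), measurable B -> history P i (X i @^-1` B).

Definition uniform01 Q (X : {mfun Omega >-> R}) : Prop :=
  forall B : set R, measurable B ->
    distribution Q X B = uniform_prob (@ltr01 R) B.

(* Mutual independence of the subfamily (P j), j in I. *)
Definition mutually_independent Q P (I : set nat) : Prop :=
  forall (J : {fset nat}) (B : nat -> set R),
    [set` J] `<=` I -> (forall j, measurable (B j)) ->
    Q (\bigcap_(j in [set` J]) (P j @^-1` B j)) =
    (\prod_(j <- J) Q (P j @^-1` B j))%E.

Definition rejects_in P (a : nat -> Omega -> R) (I : set nat) : set Omega :=
  [set w | exists2 i, I i & P i w <= a i w].

Definition procedure P (a : nat -> Omega -> R) : Prop :=
  predictable P a /\ forall i w, 0 <= a i w < 1.

Definition FWER (H : nat -> set (probability Omega R)) Q P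
    (a : nat -> Omega -> R) : \bar R :=
  Q (rejects_in P a (true_nulls H Q)).

Definition strong_FWER_control (PP : set (probability Omega R))
    (H : nat -> set (probability Omega R)) P (alpha : R)
    (a : nat -> Omega -> R) : Prop :=
  forall Q, PP Q -> (FWER H Q P a <= alpha%:E)%E.

Fixpoint running_level P (alpha : R) (tau lambda a : nat -> Omega -> R)
    (i : nat) (w : Omega) : R :=
  if i is j.+1 then
    let l := running_level P alpha tau lambda a j w in
    if lambda j w < P j w <= tau j w
    then l - a j w * (1 - l) / (tau j w - lambda j w)
    else l
  else alpha.

Definition exhaustive_ADDIS P (alpha : R)
    (tau lambda a : nat -> Omega -> R) : Prop :=
  let level := running_level P alpha tau lambda a in
  [/\ predictable P tau, predictable P lambda, predictable P a &
    forall i w,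
      [/\ 0 < tau i w <= 1,
          level i w * tau i w <= lambda i w < tau i w,
          0 <= a i w < tau i w &
          0 <= level i w
               - a i w * (1 - level i w) / (tau i w - lambda i w)]].

End online_testing.

(* Main.v *)
(* Let L_n be the running level and N_n the indicator that nothing has been
   rejected before step n. Under the global null, N_n (1 - L_n) has constant
   mean 1 - alpha: given the past, the p-value falls in (a, lambda] or above tau
   with probability 1 - a - (tau - lambda), leaving L unchanged, and in
   (lambda, tau] with probability tau - lambda, increasing 1 - L by
   a (1 - L) / (tau - lambda); these contributions sum to 1 - L. Exhaustion means
   that L_n -> 0, so by dominated convergence the procedure rejects with
   probability exactly alpha under the global null. A competitor rejecting on a
   larger event then exceeds it only by a null set of the global null, which is
   also a null set of the true distribution. *)

Require Import Defs.
From HB Require Import structures.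
From mathcomp Require Import all_boot all_order all_algebra.
From mathcomp Require Import all_classical all_reals all_analysis.
From mathcomp Require Import finmap measurable_realfun ring lra.
Import Order.TTheory GRing.Theory Num.Theory.
Import numFieldNormedType.Exports.
Local Open Scope classical_set_scope.
Local Open Scope ring_scope.

Set Implicit Arguments.
Unset Strict Implicit.

(** * Threshold indicators and the uniform law on [0, 1] *)

Lemma indic_set_bool (T : Type) (R : pzRingType) (p : T -> bool) (x : T) :
  \1_[set y | p y] x = (p x)%:R :> R.
Proof.
by rewrite indicE; congr ((nat_of_bool _)%:R); apply/idP/idP; rewrite in_setE.
Qed.

Lemma measurable_fun_ler_indic (d : measure_display) (T : measurableType d)
    (R : realType) (f g : T -> R) :
  measurable_fun setT f -> measurable_fun setT g ->
  measurable_fun setT (fun x => (f x <= g x)%R%:R : R).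
Proof.
move=> mf mg; rewrite (_ : (fun _ => _) = \1_[set x | f x <= g x]).
  apply: measurable_indic; rewrite -[X in measurable X]setTI.
  exact: measurable_fun_le.
by apply/funext => x; rewrite indic_set_bool.
Qed.

Lemma measurable_fun_inv_gt0 (d : measure_display) (T : measurableType d)
    (R : realType) (f : T -> R) :
  measurable_fun setT f -> (forall x, 0 < f x) ->
  measurable_fun setT (fun x => (f x)^-1).
Proof.
move=> mf f0; rewrite (_ : (fun _ => _) = (@powR R ^~ (-1)) \o f).
  by apply: measurableT_comp => //; exact: measurable_powR.
by apply/funext => x /=; rewrite powR_inv1// ltW.
Qed.

Lemma integral_itv01_fin_num (d : measure_display) (T : measurableType d)
    (R : realType) (Q : probability T R) (f : T -> R) :
  measurable_fun setT f -> (forall w, 0 <= f w <= 1) ->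
  (\int[Q]_w (f w)%:E)%E \is a fin_num.
Proof.
move=> mf f01; rewrite ge0_fin_numE; last first.
  by apply: integral_ge0 => w _; rewrite lee_fin; case/andP: (f01 w).
apply: (@le_lt_trans _ _ (\int[Q]_w (cst 1%:E) w)%E); last first.
  by rewrite integral_cst//= probability_setT mule1 ltry.
apply: ge0_le_integral => //.
- by move=> w _; rewrite lee_fin; case/andP: (f01 w).
- exact/measurable_EFinP.
- by move=> w _; rewrite lee_fin; case/andP: (f01 w).
Qed.

Lemma uniform_prob_le (R : realType) (c : R) : 0 <= c <= 1 ->
  uniform_prob (@ltr01 R) [set x | x <= c] = c%:E.
Proof.
move=> /andP[c0 c1].
have mI : measurable [set x : R | x <= c].
  by rewrite -set_itvNyc; exact: measurable_itv.
(* As the integral of an indicator, the probability can be rewritten by [integral_uniform] as the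
   Lebesgue measure of [[0, c]]. *)
transitivity (\int[uniform_prob (@ltr01 R)]_x (\1_[set x | x <= c] x)%:E)%E.
  by rewrite integral_indic// setIT.
rewrite integral_uniform//.
  rewrite integral_indic// subr0 invr1 mul1e.
  rewrite (_ : _ `&` _ = `[0, c]%classic).
    apply: etrans (lebesgue_measure_itv _) _ => /=.
    rewrite lte_fin oppr0 adde0; case: ltP => // c0'.
    by congr EFin; apply/le_anti/andP.
  apply/seteqP; split => x /=; rewrite !in_itv/=.
    by move=> [xc /andP[-> _]].
  by move=> /andP[-> xc]; rewrite xc (le_trans xc).
by apply/measurable_EFinP; exact: measurable_indic.
Qed.

(** * Integrating out a uniform variable independent of a sub-sigma-algebra *)

Section freezing.
Context (d : measure_display) (Omega : measurableType d) (R : realType).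
Variables (Q : probability Omega R) (X : {mfun Omega >-> R}).
Variable (G : set (set Omega)).
Hypothesis Gmeas : <<s G >> `<=` @measurable d Omega.
Hypothesis XU : uniform01 Q X.
Hypothesis GX : forall A B, <<s G >> A -> measurable B ->
  (Q (A `&` X @^-1` B) = Q A * Q (X @^-1` B))%E.

Let T := g_sigma_algebraType G.

Lemma measurable_sub_sigma (f : T -> R) :
  measurable_fun setT f -> measurable_fun setT (f : Omega -> R).
Proof.
by move=> mf _ B mB; apply: measurableI => //; apply: Gmeas;
  rewrite -[X in smallest _ _ X]setTI; exact: mf.
Qed.

(** The identity, viewed as a map into [Omega] with the smaller sigma-algebra; its law is [Q]
    restricted to [<<s G>>]. *)
Let idT (w : Omega) : T := w.
Let midT : measurable_fun setT idT.
Proof. by move=> _ B mB; rewrite setTI; exact: Gmeas. Qed.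
HB.instance Definition _ := isMeasurableFun.Build _ _ _ _ idT midT.

Let J (w : Omega) : T * R := (idT w, X w).
Let mJ : measurable_fun setT J.
Proof. exact: measurable_fun_pair. Qed.
HB.instance Definition _ := isMeasurableFun.Build _ _ _ _ J mJ.

(* X is independent of <<s G >>, so (w, X w) has a product law on T * R and Y, c
   can be frozen while integrating over X. *)
Lemma integral_threshold (Y c : T -> R) :
  measurable_fun setT Y -> measurable_fun setT c ->
  (forall w, 0 <= Y w) -> (forall w, 0 <= c w <= 1) ->
  (\int[Q]_w (Y w * (X w <= c w)%R%:R)%:E = \int[Q]_w (Y w * c w)%:E)%E.
Proof.
move=> mY mc Y0 c01.
pose F (z : T * R) : \bar R := (Y z.1 * (z.2 <= c z.1)%R%:R)%:E.
have mF : measurable_fun setT F.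
  apply/measurable_EFinP/measurable_funM.
    by apply: measurableT_comp => //; exact: measurable_fst.
  apply: measurable_fun_ler_indic; first exact: measurable_snd.
  by apply: measurableT_comp => //; exact: measurable_fst.
have F0 z : (0 <= F z)%E by rewrite lee_fin mulr_ge0.
transitivity (\int[distribution Q J]_z F z)%E.
  by rewrite ge0_integral_distribution.
(* A product measure is determined by its values on rectangles, and there the identity is exactly
   [GX]. *)
transitivity (\int[distribution Q idT \x distribution Q X]_z F z)%E.
  apply: eq_measure_integral => A mA _; apply/esym.
  by apply: product_measure_unique => // B C mB mC /=; apply: GX.
rewrite fubini_tonelli1//.
transitivity (\int[distribution Q idT]_w (Y w * c w)%:E)%E; last first.
  rewrite ge0_integral_distribution//.
    by apply/measurable_EFinP; exact: measurable_funM.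
  by move=> w; rewrite lee_fin mulr_ge0//; case/andP: (c01 w).
apply: eq_integral => w _; rewrite /fubini_F/F/=.
have mI : measurable [set x : R | x <= c w].
  by rewrite -set_itvNyc; exact: measurable_itv.
under eq_integral do rewrite EFinM.
rewrite ge0_integralZl//; last 2 first.
- exact/measurable_EFinP/measurable_fun_ler_indic.
- by rewrite lee_fin.
rewrite EFinM; congr (_ * _)%E.
transitivity (\int[distribution Q X]_x (\1_[set x : R | x <= c w] x)%:E)%E.
  by apply: eq_integral => x _; rewrite indic_set_bool.
rewrite integral_indic// setIT.
transitivity (uniform_prob (@ltr01 R) [set x | x <= c w]); first exact: XU.
exact: uniform_prob_le.
Qed.

End freezing.

(** * The filtration of the p-values *)

Section past.
Context (d : measure_display) (Omega : measurableType d) (R : realType).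
Variable P : nat -> {mfun Omega >-> R}.

(** The generators of [history P i], named so that [g_sigma_algebraType] makes a measurable type of
    the past and predictability becomes [measurable_fun]. *)
Definition past_events (i : nat) : set (set Omega) :=
  \big[setU/set0]_(j < i) preimage_set_system setT (P j) measurable.

Lemma past_eventsP i A : past_events i A <->
  exists2 j, (j < i)%N & exists2 B, measurable B & P j @^-1` B = A.
Proof.
rewrite /past_events.
rewrite -(bigcup_mkord _ (fun j => preimage_set_system setT (P j) measurable)).
split.
  by move=> [j ji [B mB <-]]; exists j => //; exists B; rewrite ?setTI.
by move=> [j ji [B mB <-]]; exists j => //; exists B; rewrite ?setTI.
Qed.

Lemma history_measurable i : history P i `<=` @measurable d Omega.
Proof.
apply: smallest_sub; first exact: sigma_algebra_measurable.
move=> A /past_eventsP[j ji [B mB <-]].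
by rewrite -[X in measurable X]setTI; exact: measurable_funP.
Qed.

Lemma history_mono i : history P i `<=` history P i.+1.
Proof.
apply: smallest_sub; first exact: smallest_sigma_algebra.
move=> A /past_eventsP[j ji HA]; apply: sub_sigma_algebra; apply/past_eventsP.
by exists j => //; exact: leqW.
Qed.

(** A generating family closed under intersection, as uniqueness of measures demands; [past_events]
    lacks this closure in general. *)
Definition past_cylinders (i : nat) : set (set Omega) :=
  [set A | exists2 B : nat -> set R, (forall j, measurable (B j)) &
    A = \bigcap_(j in `I_i) P j @^-1` B j].

Lemma history_cylinders i : history P i `<=` <<s past_cylinders i >>.
Proof.
apply: smallest_sub; first exact: smallest_sigma_algebra.
move=> A /past_eventsP[j ji [B mB <-]].
apply: sub_sigma_algebra; exists (fun k => if k == j then B else setT).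
  by move=> k; case: ifP.
apply/seteqP; split => w /=.
  by move=> Bw k _; case: eqP => // ->.
by move=> /(_ j ji); rewrite eqxx.
Qed.

(** Both sides are finite measures in [A]: a restriction of [Q] and a multiple of [Q]. They agree on
    the cylinders by mutual independence, hence on the sigma-algebra these generate. *)
Lemma history_independent (Q : probability Omega R) i A B :
  mutually_independent Q P setT -> history P i A -> measurable B ->
  (Q (A `&` P i @^-1` B) = Q A * Q (P i @^-1` B))%E.
Proof.
move=> indep /history_cylinders hA mB.
have mPB : measurable (P i @^-1` B).
  by rewrite -[X in measurable X]setTI; exact: measurable_funP.
have finI n : [set` fset_set `I_n] = `I_n by rewrite fset_setK//; exact: finite_II.
have Qcyl n C : (forall j, measurable (C j)) ->
    Q (\bigcap_(j in `I_n) P j @^-1` C j) =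
    (\prod_(j <- fset_set `I_n) Q (P j @^-1` C j))%E.
  by move=> mC; rewrite -indep// finI.
(* [mscale] takes a nonnegative real, so the probability is converted from the extended reals. *)
pose q : {nonneg R} := NngNum (fine_ge0 (measure_ge0 Q (P i @^-1` B))).
have qE : q%:num%:E = Q (P i @^-1` B) by rewrite /= fineK// fin_num_measure.
have qQ E : mscale q Q E = (Q E * Q (P i @^-1` B))%E by rewrite -qE muleC.
transitivity (mrestr Q mPB A); first by [].
transitivity (mscale q Q A); last by rewrite qQ.
apply: (g_sigma_algebra_measure_unique (past_cylinders i) _ (fun=> setT)) => //.
- move=> _ [C mC ->]; apply: fin_bigcap_measurable => [|j _].
    exact: finite_II.
  by rewrite -[X in measurable X]setTI; exact: measurable_funP.
- by move=> _; exists (fun=> setT) => //; apply/seteqP; split.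
- by rewrite bigcup_const.
- move=> _ _ [C mC ->] [D mD ->]; exists (fun j => C j `&` D j).
    by move=> j; exact: measurableI.
  by rewrite -bigcapI; apply: eq_bigcapr.
- move=> _ [C mC ->]; rewrite [RHS]qQ.
  transitivity (Q (\bigcap_(j in `I_i) P j @^-1` C j `&` P i @^-1` B)) => //.
  (* The intersection is itself a cylinder over [i.+1] coordinates with base [B] at [i], so the
     product formula applies to it as well. *)
  pose D k := if k == i then B else C k.
  rewrite (_ : _ `&` _ = \bigcap_(j in `I_i.+1) P j @^-1` D j).
    rewrite !Qcyl//; last by move=> j; rewrite /D; case: ifP.
    rewrite IISl fset_setU1//.
    rewrite big_fsetU1/=; last first.
      rewrite in_fset_set; last exact: finite_II.
      by rewrite notin_setE/= ltnn.
    rewrite /D eqxx muleC; congr (_ * _)%E.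
    rewrite !big_seq; apply: eq_bigr => j.
    rewrite in_fset_set; last exact: finite_II.
    by move=> /set_mem/= ji; rewrite ltn_eqF.
  rewrite IISl bigcap_setU1 /D eqxx setIC; congr (_ `&` _).
  by apply: eq_bigcapr => j /= ji; rewrite ltn_eqF.
- by move=> _; rewrite ltey_eq fin_num_measure.
Qed.

Let past i := g_sigma_algebraType (past_events i).

Lemma past_mono i (f : Omega -> R) :
  measurable_fun setT (f : past i -> R) ->
  measurable_fun setT (f : past i.+1 -> R).
Proof. by move=> mf _ B mB; apply: history_mono; exact: mf. Qed.

Lemma past_observed i : measurable_fun setT (P i : past i.+1 -> R).
Proof.
move=> _ B mB; rewrite setTI; apply: sub_sigma_algebra; apply/past_eventsP.
by exists i => //; exists B.
Qed.

Lemma past_predictable (X : nat -> Omega -> R) i :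
  predictable P X -> measurable_fun setT (X i : past i -> R).
Proof. by move=> pX _ B mB; rewrite setTI; exact: pX. Qed.

Lemma past_measurable i (f : Omega -> R) :
  measurable_fun setT (f : past i -> R) -> measurable_fun setT f.
Proof. by move=> mf; apply: measurable_sub_sigma mf; exact: history_measurable. Qed.

Lemma measurable_rejects (b : nat -> Omega -> R) : predictable P b ->
  measurable (rejects_in P b setT).
Proof.
move=> pb; rewrite (_ : rejects_in P b setT =
    \bigcup_i (setT `&` [set w | P i w <= b i w])).
  apply: bigcupT_measurable => i; apply: measurable_fun_le => //.
  by apply: past_measurable; exact: past_predictable.
by apply/seteqP; split => [w [i _ H]|w [i _ [_ H]]]; exists i.
Qed.

End past.

(** * Pathwise bounds on the levels *)

Section exhaustive_ADDIS_theory.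
Context (d : measure_display) (Omega : measurableType d) (R : realType).
Variables (P : nat -> {mfun Omega >-> R}) (alpha : R).
Variables (tau lambda a : nat -> Omega -> R).
Hypothesis alpha01 : 0 < alpha < 1.
Hypothesis addis : exhaustive_ADDIS P alpha tau lambda a.

Let past i := g_sigma_algebraType (past_events P i).
Let level := running_level P alpha tau lambda a.

Definition loss i w := a i w * (1 - level i w) / (tau i w - lambda i w).

Lemma lambda_lt_tau i w : lambda i w < tau i w.
Proof. by have [_ _ _ /(_ i w)[_ /andP[]]] := addis. Qed.

(** Since [lambda < tau], the difference of the two indicators is the indicator of
    [lambda < P <= tau]. This form matches the exhaustion series and involves only threshold
    indicators. *)
Lemma levelS i w : level i.+1 w =
  level i w - loss i w * ((P i w <= tau i w)%R%:R - (P i w <= lambda i w)%R%:R).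
Proof.
rewrite /level/= -/(level i w) -/(loss i w).
have lt := lambda_lt_tau i w; case: (ltP (lambda i w)) => /= Pl.
  by case: ifP => _; rewrite subr0 ?mulr1// mulr0 subr0.
by rewrite (le_trans Pl (ltW lt)) subrr mulr0 subr0.
Qed.

Lemma level_itv i w : 0 <= level i w <= alpha.
Proof.
elim: i => [|i /andP[IH0 IH1]]; first by case/andP: alpha01 => /ltW -> _ /=.
have [_ _ _ /(_ i w)[_ /andP[_ lt] /andP[a0 _]]] := addis.
rewrite -/level -/(loss i w) /level/= -/(level i w) -/(loss i w) => l0.
case: ifP => _; last by rewrite IH0.
rewrite l0/= (le_trans _ IH1)// gerBl /loss.
case/andP: alpha01 => _ /ltW al1.
by rewrite divr_ge0 ?subr_ge0 ?(ltW lt)// mulr_ge0// subr_ge0 (le_trans IH1).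
Qed.

Lemma level_lt1 i w : level i w < 1.
Proof.
by case/andP: (level_itv i w) => _ /le_lt_trans; apply; case/andP: alpha01.
Qed.

Lemma loss_itv i w : 0 <= loss i w <= 1.
Proof.
have [_ _ _ /(_ i w)[_ /andP[_ lt] /andP[a0 _]]] := addis.
rewrite -/level -/(loss i w) subr_ge0 => lL.
rewrite (le_trans lL (ltW (level_lt1 i w))) andbT.
by rewrite divr_ge0 ?subr_ge0 ?(ltW lt)// mulr_ge0// subr_ge0 ltW// level_lt1.
Qed.

(** With L the level, the constraints give a (1 - L) <= L (tau - lambda) <= L tau (1 - L), the
    latter from lambda >= L tau. Dividing by 1 - L > 0 yields a <= L tau <= lambda, so a rejection
    never lowers the level. *)
Lemma test_level_le_lambda i w : a i w <= lambda i w.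
Proof.
have [_ _ _ /(_ i w)[/andP[t0 _] /andP[ll lt] /andP[a0 _]]] := addis.
rewrite -/level subr_ge0 ler_pdivrMr ?subr_gt0// => aL.
have L0 : 0 <= level i w by case/andP: (level_itv i w).
apply: (le_trans _ ll).
rewrite -(@ler_pM2r _ (1 - level i w)) ?subr_gt0 ?level_lt1// -mulrA.
by rewrite (le_trans aL)// ler_wpM2l// mulrBr mulr1 lerB// mulrC.
Qed.

(** * The process N_n (1 - L_n) and its pathwise recursion *)

Definition unrejected n w : R := \prod_(j < n) (a j w < P j w)%R%:R.

Lemma unrejected_itv n w : 0 <= unrejected n w <= 1.
Proof.
have b01 (b : bool) : 0 <= (b%:R : R) <= 1 by rewrite ler0n lern1 leq_b1.
apply/andP; split; last by apply: prodr_ile1 => i _; exact: b01.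
by apply: prodr_ge0 => i _; case/andP: (b01 (a i w < P i w)).
Qed.

Lemma measurable_unrejected n : measurable_fun setT (unrejected n : past n -> R).
Proof.
elim: n => [|n IH].
  rewrite (_ : unrejected 0 = cst 1)//.
  by apply/funext => w; rewrite /unrejected big_ord0.
rewrite (_ : unrejected _ = fun w => unrejected n w * (1 - (P n w <= a n w)%R%:R)).
  apply: measurable_funM; first exact: past_mono.
  apply: measurable_funB => //; apply: measurable_fun_ler_indic.
    exact: past_observed.
  by apply: past_mono; apply: past_predictable; case: addis.
apply/funext => w; rewrite /unrejected big_ord_recr/= ltNge.
by case: (_ <= _); rewrite ?subrr ?subr0.
Qed.

(** Measurability of the level is a premise because this serves inside the induction that
    establishes it. *)
Lemma measurable_loss_of_level i : measurable_fun setT (level i : past i -> R) ->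
  measurable_fun setT (loss i : past i -> R).
Proof.
have [pt pl pa _] := addis.
move=> mL; apply: measurable_funM.
  apply: measurable_funM; first exact: past_predictable.
  exact: measurable_funB.
apply: measurable_fun_inv_gt0; last by move=> w; rewrite subr_gt0 lambda_lt_tau.
by apply: measurable_funB; exact: past_predictable.
Qed.

Lemma measurable_level i : measurable_fun setT (level i : past i -> R).
Proof.
have [pt pl pa _] := addis.
elim: i => [|i IH]; first exact: measurable_cst.
rewrite (_ : level i.+1 = fun w => level i w -
  loss i w * ((P i w <= tau i w)%R%:R - (P i w <= lambda i w)%R%:R)).
  apply: measurable_funB; first exact: past_mono.
  apply: measurable_funM; first exact: past_mono (measurable_loss_of_level IH).
  by apply: measurable_funB; apply: measurable_fun_ler_indic;
    [exact: past_observed|by apply: past_mono; apply: past_predictable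
    |exact: past_observed|by apply: past_mono; apply: past_predictable].
by apply/funext => w; exact: levelS.
Qed.

Definition weight n w := unrejected n w * (1 - level n w).

Lemma weight_itv n w : 0 <= weight n w <= 1.
Proof.
case/andP: (unrejected_itv n w) => u0 u1; case/andP: (level_itv n w) => l0 _.
have L1 : 0 <= 1 - level n w by rewrite subr_ge0 ltW// level_lt1.
by rewrite mulr_ge0//= mulr_ile1// gerBl.
Qed.

Lemma measurable_weight n : measurable_fun setT (weight n : past n -> R).
Proof.
apply: measurable_funM; first exact: measurable_unrejected.
by apply: measurable_funB => //; exact: measurable_level.
Qed.

(* The martingale increment, with negative terms moved across so that both
   sides can be integrated as nonnegative functions. *)
Lemma weightS n w :
  weight n.+1 w + weight n w * (P n w <= a n w)%R%:R
    + unrejected n w * loss n w * (P n w <= lambda n w)%R%:R =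
  weight n w + unrejected n w * loss n w * (P n w <= tau n w)%R%:R.
Proof.
rewrite /weight levelS /unrejected big_ord_recr/= -/(unrejected n w).
have al := test_level_le_lambda n w; have lt := ltW (lambda_lt_tau n w).
(* As [a <= lambda < tau], a rejection sets all three indicators to 1 and the next weight to 0. *)
case: (leP (P n w) (a n w)) => Pa.
  by rewrite (le_trans Pa al) (le_trans (le_trans Pa al) lt)/=; ring.
case: (leP (P n w) (lambda n w)) => Pl; first by rewrite (le_trans Pl lt)/=; ring.
by rewrite /=; ring.
Qed.

(** * Expectations under the global null *)

Section null.
Variable Q : probability Omega R.
Hypothesis unifQ : forall i, uniform01 Q (P i).
Hypothesis indepQ : mutually_independent Q P setT.

(** Integrating [weightS] and freezing the past turns each indicator into its threshold. The extra
    terms then balance because [loss] times tau - lambda equals a (1 - L). *)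
Lemma weight_mean_step n :
  (\int[Q]_w (weight n.+1 w)%:E = \int[Q]_w (weight n w)%:E)%E.
Proof.
have [pt pl pa hyp] := addis.
have freeze c : predictable P c -> (forall w, 0 <= c n w <= 1) ->
    forall Y : past n -> R, measurable_fun setT Y -> (forall w, 0 <= Y w) ->
    (\int[Q]_w (Y w * (P n w <= c n w)%R%:R)%:E = \int[Q]_w (Y w * c n w)%:E)%E.
  move=> pc c01 Y mY Y0.
  apply: (@integral_threshold _ _ _ _ _ (past_events P n)) => //.
  - exact: history_measurable.
  - by move=> A B hA mB; exact: history_independent.
  - exact: past_predictable.
(* The coefficients of the indicators in [weightS]; both depend on the past only. *)
pose Y1 := weight n; pose Y2 w := unrejected n w * loss n w.
have mY1 : measurable_fun setT (Y1 : past n -> R) := @measurable_weight n.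
have mY2 : measurable_fun setT (Y2 : past n -> R).
  apply: measurable_funM; first exact: measurable_unrejected.
  by apply: measurable_loss_of_level; exact: measurable_level.
have Y101 w : 0 <= Y1 w <= 1 := weight_itv n w.
have Y201 w : 0 <= Y2 w <= 1.
  case/andP: (unrejected_itv n w) => u0 u1; case/andP: (loss_itv n w) => l0 l1.
  by rewrite mulr_ge0//= mulr_ile1.
have t01 w : 0 <= tau n w <= 1 by case: (hyp n w) => /andP[/ltW -> ->].
have l01 w : 0 <= lambda n w <= 1.
  case/andP: (t01 w) => t0 t1; case: (hyp n w) => _ /andP[ll lt] _ _.
  rewrite (le_trans _ ll)/= ?(le_trans (ltW lt))// mulr_ge0//.
  by case/andP: (level_itv n w).
have a01 w : 0 <= a n w <= 1.
  case: (hyp n w) => _ _ /andP[-> _] _; rewrite (le_trans (test_level_le_lambda n w))//.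
  by case/andP: (l01 w).
have mO f : measurable_fun setT (f : past n -> R) -> measurable_fun [set: Omega] f.
  by move=> mf; apply: past_measurable mf.
have mm (f g : Omega -> R) : measurable_fun setT (f : past n -> R) ->
    measurable_fun [set: Omega] g -> measurable_fun [set: Omega] (fun w => (f w * g w)%:E).
  by move=> mf mg; apply/measurable_EFinP/measurable_funM => //; exact: mO.
have mc c : predictable P c -> measurable_fun [set: Omega] (c n).
  by move=> pc; apply: mO; exact: past_predictable.
have mle c : predictable P c ->
    measurable_fun [set: Omega] (fun w => (P n w <= c n w)%R%:R : R).
  by move=> pc; apply: measurable_fun_ler_indic => //; exact: mc.
have EP (f c : Omega -> R) : (forall w, 0 <= f w <= 1) -> (forall w, 0 <= c w <= 1) ->
    forall w, 0 <= f w * c w <= 1.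
  move=> f01 c01 w; case/andP: (f01 w) => f0 f1; case/andP: (c01 w) => c0 c1.
  by rewrite mulr_ge0//= mulr_ile1.
have nn (f : Omega -> R) : (forall w, 0 <= f w <= 1) -> forall w, setT w -> (0 <= (f w)%:E)%E.
  by move=> f01 w _; rewrite lee_fin; case/andP: (f01 w).
(* The common term is kept on both sides so that only nonnegative functions are integrated; it is
   cancelled at the end. *)
have key : (\int[Q]_w (weight n.+1 w)%:E + (\int[Q]_w (Y1 w * a n w)%:E
    + \int[Q]_w (Y2 w * lambda n w)%:E) =
    \int[Q]_w (weight n w)%:E + (\int[Q]_w (Y1 w * a n w)%:E
    + \int[Q]_w (Y2 w * lambda n w)%:E))%E.
  transitivity (\int[Q]_w (weight n w)%:E + \int[Q]_w (Y2 w * tau n w)%:E)%E; last first.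
    congr (_ + _)%E; rewrite -ge0_integralD//; last 4 first.
    - by apply: nn; exact: EP.
    - by apply: mm => //; exact: mc.
    - by apply: nn; exact: EP.
    - by apply: mm => //; exact: mc.
    apply: eq_integral => w _; rewrite -EFinD; congr EFin.
    have t_l := lambda_lt_tau n w.
    rewrite /Y1 /Y2 /weight /loss; field.
    by rewrite subr_eq0 gt_eqF.
  have Y10 w : 0 <= Y1 w by case/andP: (Y101 w).
  have Y20 w : 0 <= Y2 w by case/andP: (Y201 w).
  (* Freezing is used backwards: with thresholds replaced by indicators, the claim becomes the
     integral of a pointwise identity. *)
  rewrite -(freeze tau pt t01 _ mY2 Y20) -(freeze lambda pl l01 _ mY2 Y20).
  rewrite -(freeze a pa a01 _ mY1 Y10).
  have mMS : measurable_fun [set: Omega] (fun w => (weight n.+1 w)%:E).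
    by apply/measurable_EFinP; exact: past_measurable (@measurable_weight n.+1).
  have mM : measurable_fun [set: Omega] (fun w => (weight n w)%:E).
    by apply/measurable_EFinP; exact: mO.
  rewrite -[X in (_ + X = _)%E]ge0_integralD//; last 4 first.
  - by move=> w _; rewrite lee_fin mulr_ge0.
  - by apply: mm => //; exact: mle.
  - by move=> w _; rewrite lee_fin mulr_ge0.
  - by apply: mm => //; exact: mle.
  rewrite -[LHS]ge0_integralD//; last 3 first.
  - by apply: nn; exact: weight_itv.
  - by move=> w _; apply: adde_ge0; rewrite lee_fin mulr_ge0.
  - by apply: emeasurable_funD; apply: mm => //; exact: mle.
  rewrite -[RHS]ge0_integralD//; last 3 first.
  - by apply: nn; exact: weight_itv.
  - by move=> w _; rewrite lee_fin mulr_ge0.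
  - by apply: mm => //; exact: mle.
  by apply: eq_integral => w _; rewrite -!EFinD addrA; congr EFin; exact: weightS.
(* Cancellation in the extended reals requires the common term to be finite. *)
have fA : (\int[Q]_w (Y1 w * a n w)%:E + \int[Q]_w (Y2 w * lambda n w)%:E)%E \is a fin_num.
  rewrite fin_numD !integral_itv01_fin_num//.
  - by apply/measurable_EFinP; apply: mm => //; exact: mc.
  - exact: EP.
  - by apply/measurable_EFinP; apply: mm => //; exact: mc.
  - exact: EP.
by move: (congr1 (fun z => z - (\int[Q]_w (Y1 w * a n w)%:E
  + \int[Q]_w (Y2 w * lambda n w)%:E))%E key); rewrite !(addeK _ fA).
Qed.

Lemma weight_mean n : (\int[Q]_w (weight n w)%:E = (1 - alpha)%:E)%E.
Proof.
elim: n => [|n <-]; last exact: weight_mean_step.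
transitivity (\int[Q]_w cst (1 - alpha)%:E w)%E.
  by apply: eq_integral => w _; rewrite /weight /unrejected big_ord0 mul1r.
by rewrite integral_cst//= probability_setT mule1.
Qed.

(** After a rejection the product contains a zero factor for good; without one it stays 1 and the
    weight is 1 - L_n, which tends to 1. *)
Lemma weight_cvg w : level ^~ w @ \oo --> 0 ->
  weight ^~ w @ \oo --> (\1_(~` rejects_in P a setT) w : R).
Proof.
move=> l0; have [[i _ rej]|norej] := pselect (rejects_in P a setT w).
  rewrite indicE memNset/=; last by move=> nr; apply: nr; exists i.
  apply: (cvg_near_cst _) => //; near=> n.
  (* [unrejected n] covers only indices below [n], so the zero factor is present from [i.+1] on. *)
  have ni : (i < n)%N by near: n; exists i.+1.
  by rewrite /weight /unrejected (bigD1 (Ordinal ni))//= ltNge rej !mul0r.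
rewrite indicE mem_set//= -[X in _ --> X](subr0 (1 : R)).
rewrite (_ : weight ^~ w = fun n => 1 - level n w).
  by apply: cvgB => //; exact: cvg_cst.
apply/funext => n; rewrite /weight /unrejected big1 ?mul1r// => j _.
by case: ltP => // rej; case: norej; exists j.
Unshelve. all: by end_near. Qed.

(** The sum telescopes by [levelS], so a series with sum [alpha] means that the level tends to 0. *)
Lemma series_loss w : series (fun i : nat =>
    a i w * ((1 - level i w) / (tau i w - lambda i w))
    * (\1_[set x | P i x <= tau i x] w - \1_[set x | P i x <= lambda i x] w))
  = fun n => alpha - level n w.
Proof.
apply/funext; elim => [|n IH].
  by rewrite /series/= big_geq// subrr.
rewrite seriesSr IH levelS !indic_set_bool /loss mulrA; ring.
Qed.

(** The weights lie in [0, 1] and converge almost everywhere to the indicator of no rejection, so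
    its probability is their constant mean 1 - alpha. *)
Lemma rejects_probability : {ae Q, forall w, level ^~ w @ \oo --> 0} ->
  Q (rejects_in P a setT) = alpha%:E.
Proof.
move=> l0; have pa : predictable P a by case: addis.
have mrej := measurable_rejects pa.
have mW n : measurable_fun [set: Omega] (fun w => (weight n w)%:E).
  by apply/measurable_EFinP; exact: past_measurable (@measurable_weight n).
have [||||_ _] := @dominated_convergence _ _ _ Q setT measurableT
  (fun n w => (weight n w)%:E) (fun w => (\1_(~` rejects_in P a setT) w)%:E)
  (cst 1%E) mW.
- by apply/measurable_EFinP/measurable_indic; exact: measurableC.
- by apply: filterS l0 => w /weight_cvg wl _; apply/fine_cvgP; split;
    first exact: nearW.
- exact: finite_measure_integrable_cst.
- apply/aeW => w n _ /=; rewrite lee_fin.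
  by case/andP: (weight_itv n w) => w0 w1; rewrite ger0_norm.
rewrite (_ : (fun _ => _) = cst (1 - alpha)%:E); last first.
  by apply/funext => n; rewrite weight_mean.
rewrite integral_indic ?setIT//; last exact: measurableC.
move=> /(cvg_lim (@ereal_hausdorff _)); rewrite lim_cst//.
rewrite /= probability_setC//.
have : Q (rejects_in P a setT) \is a fin_num by exact: fin_num_measure.
move: (Q _) => [r||]//= _; rewrite -EFinB => -[H]; congr EFin; lra.
Qed.

End null.
End exhaustive_ADDIS_theory.

(** * Comparison with a competing procedure *)

Unset Implicit Arguments.

Theorem theorem3p5 (d : measure_display) (Omega : measurableType d)
  (R : realType)
  (PP : set (probability Omega R))
  (H : nat -> set (probability Omega R))
  (P : nat -> {mfun Omega >-> R})
  (Ptrue Pnull : probability Omega R)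
  (alpha : R) (tau lambda a : nat -> Omega -> R)
  (P01 : forall i w, 0 <= P i w <= 1)
  (PP_true : PP Ptrue)
  (PP_null : PP Pnull)
  (global_null : true_nulls H Pnull = [set: nat])
  (alpha01 : 0 < alpha < 1)
  (addis : exhaustive_ADDIS P alpha tau lambda a)
  (nulls_uniform : forall Q : probability Omega R, PP Q ->
     forall i, true_nulls H Q i -> uniform01 Q (P i))
  (nulls_independent : forall Q : probability Omega R, PP Q ->
     mutually_independent Q P (true_nulls H Q))
  (exhausted : {ae Pnull, forall w,
     series (fun i : nat =>
       a i w * ((1 - running_level P alpha tau lambda a i w)
                  / (tau i w - lambda i w))
       * (\1_[set x | P i x <= tau i x] w
          - \1_[set x | P i x <= lambda i x] w)) @ \oo --> alpha})
  (null_dominates_true : forall E : set Omega, measurable E ->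
     Pnull E = 0%E -> Ptrue E = 0%E) :
  ~ exists at' : nat -> Omega -> R,
      [/\ procedure P at',
          strong_FWER_control PP H P alpha at',
          rejects_in P a [set: nat] `<=` rejects_in P at' [set: nat] &
          (0 < Ptrue (rejects_in P at' [set: nat]
                      `\` rejects_in P a [set: nat]))%E].
Proof.
move=> [b [[pb _] ctrl ab]].
have unif i : uniform01 Pnull (P i) by apply: nulls_uniform; rewrite ?global_null.
have indep : mutually_independent Pnull P setT.
  by rewrite -global_null; exact: nulls_independent.
have [_ _ pa _] := addis.
have ma := measurable_rejects pa.
have mb := measurable_rejects pb.
have Qa : Pnull (rejects_in P a setT) = alpha%:E.
  apply: (rejects_probability alpha01 addis unif indep).
  apply: filterS exhausted => w; rewrite (series_loss addis) => conv.
  rewrite -[X in _ --> X](subrr alpha).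
  rewrite (_ : (fun n => _) = fun n =>
      alpha - (alpha - running_level P alpha tau lambda a n w)).
    by apply: cvgB => //; exact: cvg_cst.
  by apply/funext => n; rewrite subKr.
(* Under the global null every rejection is false, so the FWER is the probability of any
   rejection. *)
have Qb : (Pnull (rejects_in P b setT) <= alpha%:E)%E.
  by have := ctrl _ PP_null; rewrite /FWER global_null.
have PD : (Pnull (rejects_in P b setT `\` rejects_in P a setT) =
    Pnull (rejects_in P b setT) - Pnull (rejects_in P a setT))%E.
  by rewrite measureD// ?(setIidr ab)// ltey_eq fin_num_measure.
(* The difference has null probability at most alpha - alpha = 0, so its true probability also
   vanishes, contradicting positivity. *)
rewrite null_dominates_true ?ltxx//; first exact: measurableD.
by apply/eqP; rewrite eq_le measure_ge0 andbT PD Qa sube_le0.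
Qed.
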